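(* Fix integers $k\ge 2$, $g\ge 1$, $T\ge 2$, groups $G_1,\dots,G_g\subseteq[k]$ and bounds $0\le \ell_i\le u_i\le 1$, and let $$\mathcal C=\Big\{p\in\mathbb R^k:\ p_a\ge 0\ \forall a,\ \textstyle\sum_{a=1}^k p_a=1,\ \ell_i\le \sum_{a\in G_i}p_a\le u_i\ \ \forall i\in[g]\Big\},$$ a polytope. Let $\mu^\star\in[0,1]^k$ be the unknown vector of mean rewards of the $k$ arms, and assume $\gamma>0$, where $\gamma$ is defined in the context. Let $\eta>0$ and let $q_f\in\mathcal C$ satisfy $$\{x\in\mathbb R^k:\ \|x-q_f\|_\infty\le \eta,\ \textstyle\sum_a x_a=1\}\subseteq \mathcal C.$$ Run the Constrained-$\varepsilon$-Greedy algorithm described in the context for $T$ rounds, with input $L=d:=\min\{\gamma,1/2\}$, so that $\epsilon_t=\min\{1,4/(\eta d^2 t)\}$. Then there is an absolute constant $C>0$, independent of $k,T,\eta,\gamma,\mu^\star$ and of the constraints, such that $$\mathbb E[\mathsf{FairRegret}_T]\le C\,\frac{\log T}{\eta\,\gamma^2}.$$ The expectation is over the random rewards and the random arm choices.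
   Context: Setting (a single context). There are $k$ arms. In each round $t$, the algorithm chooses a distribution on $[k]$ and samples an arm $a^t$ from it. It then observes a reward $r_t\sim\mathrm{Bernoulli}(\mu^\star_{a^t})$, drawn independently across rounds given the chosen arm. Let $V(\mathcal C)$ be the vertex set of $\mathcal C$ and let $v^\star=\arg\max_{v\in V(\mathcal C)}\sum_a\mu^\star_a v_a$. Define $$\gamma:=\sum_a\mu^\star_a v^\star_a-\max_{v\in V(\mathcal C)\setminus\{v^\star\}}\sum_a\mu^\star_a v_a .$$ The assumption $\gamma>0$ includes that the maximizing vertex is unique. The fair regret is $$\mathsf{FairRegret}_T:=T\cdot\max_{p\in\mathcal C}\ \mu^{\star\top}p-\sum_{t=1}^T r_t .$$ Constrained-$\varepsilon$-Greedy, with inputs $\mathcal C$, $q_f$, $T$ and a constant $L>0$: - Initialize the empirical mean vector $\bar\mu_1=0\in\mathbb R^k$. - For $t=1,\dots,T$: - set $\epsilon_t=\min\{1,4/(\eta L^2 t)\}$; - compute $p^t\in\arg\max_{p\in\mathcal C}\bar\mu_t^\top p$; - sample an arm $a^t$ from the distribution $(1-\epsilon_t)p^t+\epsilon_t q_f$; - observe $r_t$; - set $\bar\mu_{t+1,a}$ equal to the average of the rewards observed so far when arm $a$ was played, for each arm $a$ (this entry remains $0$ if arm $a$ has never been played). *)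

(* Defs.v *)
From mathcomp Require Import all_boot all_order all_algebra.
From mathcomp Require Import reals exp.
Set Implicit Arguments. Unset Strict Implicit. Unset Printing Implicit Defensive.
Import Order.TTheory GRing.Theory Num.Theory.
Local Open Scope ring_scope.

Section Defs.
Variable R : realType.
Variable k : nat.

Definition dotv (x y : 'I_k -> R) : R := \sum_(a < k) x a * y a.

Definition fair_polytope (g : nat) (G : 'I_g -> {set 'I_k})
    (lo up : 'I_g -> R) (p : 'I_k -> R) : Prop :=
  (forall a, 0 <= p a) /\ (\sum_(a < k) p a = 1) /\
  (forall i, lo i <= \sum_(a in G i) p a <= up i).

Definition is_vertex (C : ('I_k -> R) -> Prop) (v : 'I_k -> R) : Prop :=
  C v /\ forall x y (lam : R), C x -> C y -> 0 < lam < 1 ->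
    (forall a, v a = lam * x a + (1 - lam) * y a) -> x = y.

(* gam is the gap  mu.v* - max_{v in V(C), v <> v*} mu.v, where v* is the
   unique maximizing vertex (uniqueness follows when gam > 0). *)
Definition vertex_gap (C : ('I_k -> R) -> Prop) (mu : 'I_k -> R) (gam : R)
  : Prop :=
  exists vs, is_vertex C vs /\
    (forall v, is_vertex C v -> v <> vs -> dotv mu v + gam <= dotv mu vs) /\
    (exists v, is_vertex C v /\ v <> vs /\ dotv mu v + gam = dotv mu vs).

Definition is_max_value (C : ('I_k -> R) -> Prop) (mu : 'I_k -> R) (m : R)
  : Prop :=
  (exists p, C p /\ dotv mu p = m) /\ (forall p, C p -> dotv mu p <= m).

Variable T : nat.
(* a history: round i (i.e. t = i+1) records the played arm and the
   observed reward (true = 1, false = 0) *)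
Definition history := {ffun 'I_T -> 'I_k * bool}.

Definition npulls (h : history) (i : nat) (a : 'I_k) : nat :=
  \sum_(j < T | (j < i)%N && ((h j).1 == a)) 1%N.

Definition sumrew (h : history) (i : nat) (a : 'I_k) : R :=
  \sum_(j < T | (j < i)%N && ((h j).1 == a)) ((h j).2)%:R.

(* empirical mean vector used at round t = i+1 (0 for unplayed arms) *)
Definition emp_mean (h : history) (i : nat) (a : 'I_k) : R :=
  if npulls h i a == 0%N then 0 else sumrew h i a / (npulls h i a)%:R.

Definition eps_t (eta L : R) (t : nat) : R :=
  Num.min 1 (4 / (eta * L ^+ 2 * t%:R)).

(* probability of the history h under Constrained-eps-Greedy, where
   sel t mbar is the maximizer p^t in argmax_{p in C} mbar.p chosen at round t *)
Definition hist_prob (sel : nat -> ('I_k -> R) -> ('I_k -> R))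
    (qf mu : 'I_k -> R) (eta L : R) (h : history) : R :=
  \prod_(i < T)
    (let t := i.+1 in
     let e := eps_t eta L t in
     let pt := sel t (emp_mean h i) in
     let a := (h i).1 in
     ((1 - e) * pt a + e * qf a) *
     (if (h i).2 then mu a else 1 - mu a)).

Definition exp_fair_regret (sel : nat -> ('I_k -> R) -> ('I_k -> R))
    (qf mu : 'I_k -> R) (eta L opt : R) : R :=
  \sum_(h : history) hist_prob sel qf mu eta L h *
    (T%:R * opt - \sum_(i < T) ((h i).2)%:R).

End Defs.

(* Main.v *)
Require Import Defs.
From mathcomp Require Import all_boot all_order all_algebra.
From mathcomp Require Import ring lra.
From mathcomp Require Import boolp reals sequences exp.
Import Order.TTheory GRing.Theory Num.Theory.
Local Open Scope ring_scope.
Set Implicit Arguments. Unset Strict Implicit. Unset Printing Implicit Defensive.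

(* Let d = min(gamma, 1/2) and t0 = 4/(eta d^2).  A union bound over the arms
   would cost a factor k; it is avoided by treating overestimation and
   underestimation asymmetrically.  If a vertex v <> v* beats v* for the
   empirical means m, then d <= mu.(v* - v) <= (m - mu).v + (mu - m).v*, so that
   mu.(v* - v) <= 8 (sum_a v_a (m_a - mu_a - d/8)^+
                     + sum_a v*_a (mu_a - m_a - 3d/4)^+),
   and this extends from vertices to every maximizer p^t of m.
   Both positive parts are dominated by exponentials of sums over the pulls of a
   of centred rewards with a negative drift, which shrink in conditional mean by
   a factor 1 - kappa P(a^t = a) at each round.
   - Overestimation: the arm is then itself played with probability at least
     (1 - eps_t) p^t_a, so the total cost telescopes to at most 1/kappa per arm,
     and k/kappa = O(1/(eta d^2)) because q_f >= eta forces k eta <= 1.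
   - Underestimation: exploration alone gives the decay prod_s (1 - eps_s/t0)
     <= 2 t0/t for each arm, and averaging over the fixed distribution v* does
     not involve k. *)

(** * Polytope geometry: reduction from points to vertices *)

Section Polytope.
Variables (R : realType) (k g : nat) (G : 'I_g -> {set 'I_k}).

(** One finite index type for all inequality constraints makes the tight ones a finite set that can
    be counted. Zero bounds give the linear part [lslack], the slope of a slack along a
    direction. *)
Definition slack (lo up : 'I_g -> R) (j : 'I_k + ('I_g + 'I_g))
    (p : 'I_k -> R) : R :=
  match j with
  | inl a => p a
  | inr (inl i) => \sum_(a in G i) p a - lo i
  | inr (inr i) => up i - \sum_(a in G i) p a
  end.

Notation lslack := (slack (fun=> 0) (fun=> 0)).

Variables lo up : 'I_g -> R.
Local Notation C := (fair_polytope G lo up).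

Lemma slack_line j (p u : 'I_k -> R) (s : R) :
  slack lo up j (fun a => p a + s * u a) = slack lo up j p + s * lslack j u.
Proof.
by case: j => [a|[i|i]] /=; rewrite ?big_split /= -?mulr_sumr; ring.
Qed.

Lemma fair_slackP (p : 'I_k -> R) :
  C p <-> \sum_a p a = 1 /\ forall j, 0 <= slack lo up j p.
Proof.
split=> [[p0 [p1 pG]]|[p1 ps]].
  split=> // -[a|[i|i]] /=; [exact: p0| |];
    by have /andP[] := pG i; rewrite subr_ge0.
split; first by move=> a; have := ps (inl a).
split=> // i; have := ps (inr (inl i)); have := ps (inr (inr i)) => /=.
by rewrite !subr_ge0 => -> ->.
Qed.

Definition tight (p : 'I_k -> R) := [set j | slack lo up j p == 0].

(** Ratio test: the step is the least ratio of slack to rate of decrease over the constraints that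
    decrease along [u], of which [a0] is one. The minimizing constraint becomes tight and the tight
    ones stay so. *)
Lemma push_to_facet (p u : 'I_k -> R) a0 :
  C p -> \sum_a u a = 0 -> u a0 < 0 ->
  (forall j, slack lo up j p = 0 -> lslack j u = 0) ->
  exists2 s, 0 < s &
    let q := fun a => p a + s * u a in C q /\ (#|tight p| < #|tight q|)%N.
Proof.
move=> Cp u0 ua0 utight; have [p1 ps] := (fair_slackP p).1 Cp.
pose r j := slack lo up j p / - lslack j u.
have P0 : lslack (inl a0) u < 0 by [].
case: (@Order.TotalTheory.arg_minP _ _ _ (inl a0)
  (fun j => lslack j u < 0) r P0) => j0 j0neg j0min.
have spos j : lslack j u < 0 -> 0 < slack lo up j p.
  move=> jneg; rewrite lt_neqAle ps andbT; apply/eqP => /esym/utight e.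
  by rewrite e ltxx in jneg.
have r0 : 0 < r j0 by rewrite divr_gt0 ?oppr_gt0// spos.
exists (r j0) => //=; split.
  apply/fair_slackP; split.
    by rewrite big_split /= -mulr_sumr u0 mulr0 addr0.
  move=> j; rewrite slack_line; have [jneg|jpos] := ltP (lslack j u) 0.
    have := j0min j jneg; rewrite {2}/r ler_pdivlMr ?oppr_gt0//; lra.
  by rewrite addr_ge0// mulr_ge0// ltW.
apply: proper_card; apply/properP; split.
  apply/subsetP => j; rewrite !inE slack_line => /eqP e.
  by rewrite e utight// mulr0 addr0.
exists j0; rewrite !inE ?slack_line; last by rewrite gt_eqF ?spos.
rewrite /r invrN mulrN mulNr divfK ?subrr// lt_eqF//.
Qed.

(* A non-vertex lies inside a segment, and pushing it both ways along the segment
   until a new constraint is tight writes it as a mix of two points with more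
   tight constraints. *)
Lemma fair_polytope_ind (Q : ('I_k -> R) -> Prop) :
  (forall v, is_vertex C v -> Q v) ->
  (forall x y lam, C x -> C y -> 0 < lam < 1 -> Q x -> Q y ->
     Q (fun a => lam * x a + (1 - lam) * y a)) ->
  forall p, C p -> Q p.
Proof.
move=> Qv Qmix p.
(* Induction on the number of constraints that are not tight at [p]. *)
have [n] := ubnP (#|[set: 'I_k + ('I_g + 'I_g)]| - #|tight p|)%N.
elim: n p => // n IH p; rewrite ltnS => tp Cp.
have [/Qv//|nv] := pselect (is_vertex C p).
have [x [y [lam [Cx Cy lam01 pE xy]]]] : exists x y lam,
    [/\ C x, C y, 0 < lam < 1,
        forall a, p a = lam * x a + (1 - lam) * y a & x <> y].
  apply: contrapT => H; apply: nv; split=> // x y lam Cx Cy lam01 pE.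
  by apply: contrapT => xy; apply: H; exists x, y, lam.
have [p1 ps] := (fair_slackP p).1 Cp.
have [x1 xs] := (fair_slackP x).1 Cx; have [y1 ys] := (fair_slackP y).1 Cy.
pose u a := y a - x a.
have u0 : \sum_a u a = 0 by rewrite sumrB x1 y1 subrr.
have slackp j : slack lo up j p = lam * slack lo up j x
    + (1 - lam) * slack lo up j y.
  have -> : p = (fun a => x a + (1 - lam) * u a).
    by apply: funext => a; rewrite pE /u; ring.
  have -> : y = (fun a => x a + 1 * u a).
    by apply: funext => a; rewrite /u; ring.
  by rewrite !slack_line; ring.
have uE j : lslack j u = slack lo up j y - slack lo up j x.
  have yE : y = (fun a => x a + 1 * u a).
    by apply: funext => a; rewrite /u; ring.
  by rewrite [in slack _ _ _ y]yE slack_line; ring.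
(* The slack at [p] mixes two nonnegative slacks with positive weights, so if it vanishes both
   do. *)
have utight j : slack lo up j p = 0 -> lslack j u = 0.
  move=> e; rewrite uE; have := xs j; have := ys j; move: e; rewrite slackp.
  by move/andP: lam01 => [l0 l1] ???; nra.
have nutight j : slack lo up j p = 0 -> lslack j (fun a => - u a) = 0.
  move=> /utight; case: j => [a|[i|i]] /=; rewrite ?sumrN; lra.
have [b ub] : exists b, u b != 0.
  apply: contrapT => H; apply: xy; apply: funext => a.
  by apply/esym/eqP; rewrite -subr_eq0; apply/negP => /negP ?; apply: H; exists a.
(* Boundedness enters here: a nonzero direction of sum zero has a negative entry, so a sign
   constraint stops the motion both along [u] and along its opposite. *)
have neg (w : 'I_k -> R) : \sum_a w a = 0 -> (exists b, w b != 0) ->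
    exists a, w a < 0.
  move=> w0 [c wc]; apply: contrapT => H.
  have wge a : 0 <= w a by rewrite leNgt; apply/negP => ?; apply: H; exists a.
  have /(_ c isT)/eqP := psumr_eq0P (fun a _ => wge a) w0.
  by rewrite (negbTE wc).
have [a0 ua0] := neg u u0 (ex_intro _ b ub).
have nu0 : \sum_a - u a = 0 by rewrite sumrN u0 oppr0.
have [a1 ua1] : exists a, - u a < 0.
  by apply: neg => //; exists b; rewrite oppr_eq0.
have [s s0 [Cs ts]] := push_to_facet Cp u0 ua0 utight.
have [s' s'0 [Cs' ts']] := push_to_facet Cp nu0 ua1 nutight.
have smaller q : (#|tight p| < #|tight q|)%N ->
    (#|[set: 'I_k + ('I_g + 'I_g)]| - #|tight q| < n)%N.
  move=> tq; apply: leq_trans tp; apply: ltn_sub2l => //.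
  by apply: leq_trans tq _; rewrite subset_leq_card.
(* Weights inversely proportional to the step lengths make the two displacements cancel. *)
have -> : p = (fun a => s' / (s + s') * (p a + s * u a)
                 + (1 - s' / (s + s')) * (p a + s' * - u a)).
  by apply: funext => a; field; lra.
have ss : 0 < s + s' by lra.
apply: Qmix => //; [|exact: IH (smaller _ ts) Cs|exact: IH (smaller _ ts') Cs'].
by rewrite divr_gt0//= ltr_pdivrMr//; lra.
Qed.

End Polytope.

(** * Expectations over finite histories driven by an adapted kernel *)

Section Histories.
Variables (R : realType) (X : finType) (T : nat).
Local Notation H := {ffun 'I_T -> X}.

Definition upd (h : H) (i : 'I_T) (x : X) : H :=
  [ffun j => if j == i then x else h j].

(** Swapping the entry of round [i] with a spare draw is an involution on pairs of a history and a
    draw. *)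
Lemma sum_upd (f : H -> R) i (x0 : X) :
  \sum_h f h = #|X|%:R^-1 * \sum_h \sum_x f (upd h i x).
Proof.
have cX : (#|X|%:R : R) != 0 by rewrite pnatr_eq0 -lt0n; apply/card_gt0P; exists x0.
rewrite pair_bigA /= (reindex (fun q : H * X => (upd q.1 i q.2, q.1 i))) /=.
  rewrite (eq_bigr (fun q : H * X => f q.1)).
    rewrite -(pair_bigA _ (fun h _ => f h)) /=.
    by under [in RHS]eq_bigr do rewrite sumr_const -mulr_natl; rewrite -mulr_sumr mulKf.
  move=> [h x] _ /=; congr f; apply/ffunP => j; rewrite !ffunE.
  by case: eqP => // ->.
apply: onW_bij; apply: inv_bij => -[h x] /=; congr pair; last by rewrite ffunE eqxx.
by apply/ffunP => j; rewrite !ffunE; case: eqP => // ->.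
Qed.

(** Measurability with respect to the first [n] rounds, which are numbered from 0. *)
Definition adapted (A : Type) n (F : H -> A) :=
  forall h (i : 'I_T) x, (n <= i)%N -> F (upd h i x) = F h.

Variable K : 'I_T -> H -> X -> R.
Hypothesis K_adapted : forall i : 'I_T, adapted i (K i).
Hypothesis K_sum1 : forall i h, \sum_x K i h x = 1.
Variable x0 : X.

(* Rounds from n on are replaced by uniform draws, so that every partial
   expectation lives on the full history space. *)
Definition weight n (h : H) : R :=
  \prod_(i < T) if (i < n)%N then K i h (h i) else #|X|%:R^-1.

Definition expect n (F : H -> R) : R := \sum_h weight n h * F h.

(** One step of the tower rule. Earlier kernels do not see round [n] and later rounds are still
    uniform, so redrawing round [n] changes only its own factor. *)
Lemma expect_step (n : 'I_T) F :
  expect n.+1 F = expect n (fun h => \sum_x K n h x * F (upd h n x)).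
Proof.
have cX : (#|X|%:R : R) != 0 by rewrite pnatr_eq0 -lt0n; apply/card_gt0P; exists x0.
rewrite /expect (sum_upd _ n x0) mulr_sumr; apply: eq_bigr => h _.
rewrite !mulr_sumr; apply: eq_bigr => x _.
rewrite /weight (bigD1 n)//= [in RHS](bigD1 n)//= ltnSn ltnn ffunE eqxx.
rewrite (K_adapted h x (leqnn n)).
rewrite (eq_bigr (fun i : 'I_T => if (i < n)%N then K i h (h i) else #|X|%:R^-1)).
  by rewrite !mulrA; congr (_ * _); rewrite -!mulrA; congr (_ * _); rewrite mulrC.
move=> i ni; rewrite ffunE (negbTE ni) ltnS leq_eqVlt.
have -> : (i == n :> nat) = false by apply/negbTE; rewrite -(inj_eq val_inj) in ni.
by case: ltnP => //= lt_in; rewrite K_adapted// ltnW.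
Qed.

Lemma expect_adapted n m F : (n <= m)%N -> (m <= T)%N -> adapted n F ->
  expect m F = expect n F.
Proof.
elim: m => [|m IH]; first by rewrite leqn0 => /eqP->.
rewrite leq_eqVlt => /predU1P[->//|]; rewrite ltnS => nm mT aF.
rewrite -IH// 1?ltnW// (expect_step (Ordinal mT)); apply: eq_bigr => h _.
congr (_ * _); rewrite -[RHS]mul1r -(K_sum1 (Ordinal mT) h) mulr_suml.
by apply: eq_bigr => x _; rewrite aF.
Qed.

(** Conditioning on the past of round [i] under the full law: later rounds integrate out on both
    sides, leaving the horizons [i.+1] and [i] to compare. *)
Lemma expect_cond (i : 'I_T) F : adapted i.+1 F ->
  expect T F = expect T (fun h => \sum_x K i h x * F (upd h i x)).
Proof.
move=> aF; rewrite (expect_adapted _ _ aF) ?ltn_ord// expect_step.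
rewrite [RHS](@expect_adapted i)// 1?ltnW// => h j x ij.
rewrite K_adapted//; apply: eq_bigr => y _; congr (_ * _).
(* Overwriting round [i] is undone by the draw; overwriting a later round commutes with the draw and
   is invisible to [F]. *)
have [->|nij] := eqVneq j i; first by congr F; apply/ffunP => l; rewrite !ffunE; case: eqP.
have {}ij : (i < j)%N by rewrite ltn_neqAle ij andbT eq_sym (inj_eq val_inj).
rewrite -[RHS](aF _ j x ij); congr F; apply/ffunP => l; rewrite !ffunE.
by case: (eqVneq l i) => // ->; rewrite eq_sym (negbTE nij).
Qed.

Lemma expect_cst c : expect T (fun=> c) = c.
Proof.
rewrite (@expect_adapted 0)// /expect -mulr_suml.
rewrite /weight (eq_bigr (fun=> (#|X|%:R^-1) ^+ T)).
  have cX : (#|X|%:R : R) != 0 by rewrite pnatr_eq0 -lt0n; apply/card_gt0P; exists x0.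
  rewrite sumr_const card_ffun card_ord -[_ *+ _]mulr_natl natrX exprVn mulfV ?mul1r//.
  by rewrite expf_neq0.
by move=> h _; rewrite prodr_const card_ord.
Qed.

Lemma expectD n F F' :
  expect n (fun h => F h + F' h) = expect n F + expect n F'.
Proof. by rewrite -big_split; apply: eq_bigr => h _; rewrite mulrDr. Qed.

Lemma expectZ n c F : expect n (fun h => c * F h) = c * expect n F.
Proof. by rewrite mulr_sumr; apply: eq_bigr => h _; rewrite mulrCA. Qed.

Lemma expect_sum n (I : Type) (r : seq I) (P : pred I) (F : I -> H -> R) :
  expect n (fun h => \sum_(i <- r | P i) F i h)
  = \sum_(i <- r | P i) expect n (F i).
Proof.
rewrite [RHS]exchange_big; apply: eq_bigr => h _; rewrite mulr_sumr.
by apply: eq_bigr.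
Qed.

Hypothesis K_ge0 : forall i h x, 0 <= K i h x.

Lemma expect_le n F F' :
  (forall h, F h <= F' h) -> expect n F <= expect n F'.
Proof.
move=> le; apply: ler_sum => h _; rewrite ler_wpM2l//.
by apply: prodr_ge0 => i _; case: ifP => // _; rewrite invr_ge0.
Qed.

End Histories.

(** * Exponential moments of Bernoulli rewards and logarithm bounds *)

Lemma expR_le_quadratic (R : realType) (x : R) :
  x <= 3^-1 -> expR x <= 1 + x + x ^+ 2.
Proof.
move=> x3.
(* exp x = 1 / exp (- x / 2)^2 and exp (- x / 2) >= 1 - x / 2. *)
have -> : expR x = (expR (- (x / 2)) ^+ 2)^-1.
  rewrite expr2 -expRD -expRN; congr expR; by field.
have h1 : 1 - x / 2 <= expR (- (x / 2)) by exact: expR_ge1Dx.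
have h0 : 0 < 1 - x / 2 by lra.
apply: (@le_trans _ _ ((1 - x / 2) ^+ 2)^-1).
  rewrite lef_pV2 ?posrE ?exprn_gt0 ?expR_gt0// lerXn2r// ?nnegrE; last exact: expR_ge0.
  exact: ltW.
rewrite -[_^-1]mul1r ler_pdivrMr ?exprn_gt0//.
(* The excess over 1 is nonnegative because [x <= 1/3] gives [1 - 3 * x >= 0]. *)
have -> : (1 + x + x ^+ 2) * (1 - x / 2) ^+ 2
  = 1 + x ^+ 2 * (1 / 4 * (1 - 3 * x + x ^+ 2)) by field.
by rewrite lerDl mulr_ge0 ?sqr_ge0//; have := sqr_ge0 x; lra.
Qed.

(** In the quadratic bound the linear terms average to [- l * c], and the squares to [l ^+ 2] times
    variance plus [c ^+ 2]. The variance is at most 1/4, with defect [(mu - 1/2) ^+ 2]. *)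
Lemma bernoulli_mgf (R : realType) (mu l c : R) :
  0 <= mu <= 1 -> 0 <= l <= 3^-1 -> 0 <= c ->
  mu * expR (l * ((1 - mu) - c)) + (1 - mu) * expR (l * (- mu - c))
    <= 1 - l * c + l ^+ 2 * (4^-1 + c ^+ 2).
Proof.
move=> /andP[mu0 mu1] /andP[l0 l3] c0.
have x1 : l * ((1 - mu) - c) <= 3^-1 by nra.
have x0 : l * (- mu - c) <= 3^-1 by nra.
have mu'0 : 0 <= 1 - mu by lra.
apply: le_trans (lerD (ler_wpM2l mu0 (expR_le_quadratic x1))
  (ler_wpM2l mu'0 (expR_le_quadratic x0))) _.
by have := mulr_ge0 (sqr_ge0 l) (sqr_ge0 (mu - 2^-1)); lra.
Qed.

Lemma bernoulli_mgfN (R : realType) (mu l c : R) :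
  0 <= mu <= 1 -> 0 <= l <= 3^-1 -> 0 <= c ->
  mu * expR (l * (mu - 1 - c)) + (1 - mu) * expR (l * (mu - c))
    <= 1 - l * c + l ^+ 2 * (4^-1 + c ^+ 2).
Proof.
move=> /andP[mu0 mu1] lh c0.
rewrite [leLHS]addrC; have := @bernoulli_mgf R (1 - mu) l c _ lh c0.
by rewrite subKr opprB; apply; lra.
Qed.

Lemma harmonic_le_ln (R : realType) n :
  \sum_(i < n.+1) (i.+1%:R)^-1 <= 1 + ln n.+1%:R :> R.
Proof.
elim: n => [|n IH]; first by rewrite big_ord1 ln1 invr1 addr0.
rewrite big_ord_recr /=; apply: le_trans (lerD IH (lexx _)) _.
have p1 : (0 : R) < n.+1%:R by rewrite ltr0n.
have p2 : (0 : R) < n.+2%:R by rewrite ltr0n.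
have : ln (n.+1%:R / n.+2%:R : R) <= n.+1%:R / n.+2%:R - 1.
  have := @le_ln1Dx R (n.+1%:R / n.+2%:R - 1).
  rewrite addrCA subrr addr0; apply.
  by rewrite ltrBrDr addNr divr_gt0.
rewrite ln_div ?posrE//.
have -> : n.+1%:R / n.+2%:R - 1 = - (n.+2%:R)^-1 :> R.
  apply: (mulIf (lt0r_neq0 p2)); rewrite mulrBl divfK ?lt0r_neq0// mulNr mulVf ?lt0r_neq0//.
  by rewrite -[n.+2%:R]natr1; lra.
by rewrite -addrA lerD2l lerBlDl lerBrDr.
Qed.

Lemma half_le_ln n (R : realType) : (2 <= n)%N -> 2^-1 <= ln n%:R :> R.
Proof.
move=> n2; apply: (@le_trans _ _ (ln 2%:R)).
  have := @le_ln1Dx R (2^-1 - 1).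
  rewrite addrCA subrr addr0 lnV ?posrE//; have : -1 < 2^-1 - 1 :> R by lra.
  by move=> h /(_ h); lra.
by rewrite ler_ln ?posrE ?ltr0n// ?ler_nat//; apply: leq_trans n2.
Qed.

(** * Deterministic analysis of the greedy choice *)

Section Greedy.
Variables (R : realType) (k g : nat) (G : 'I_g -> {set 'I_k}) (lo up : 'I_g -> R).
Local Notation C := (fair_polytope G lo up).

Lemma dotv_mix (m x y : 'I_k -> R) lam :
  dotv m (fun a => lam * x a + (1 - lam) * y a)
  = lam * dotv m x + (1 - lam) * dotv m y.
Proof. by rewrite /dotv !mulr_sumr -big_split; apply: eq_bigr => a _ /=; ring. Qed.

Lemma dotvC (x y : 'I_k -> R) : dotv x y = dotv y x.
Proof. by apply: eq_bigr => a _; rewrite mulrC. Qed.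

Lemma dotv_ge0 (x y : 'I_k -> R) :
  (forall a, 0 <= x a) -> (forall a, 0 <= y a) -> 0 <= dotv x y.
Proof. by move=> x0 y0; apply: sumr_ge0 => a _; rewrite mulr_ge0. Qed.

Lemma dotv_le_simplex (p x f : 'I_k -> R) c :
  C p -> (forall a, x a <= f a + c) -> dotv p x <= dotv p f + c.
Proof.
move=> [p0 [p1 _]] xf; rewrite -[c in leRHS]mul1r -p1 mulr_suml -big_split.
by apply: ler_sum => a _ /=; rewrite -mulrDr ler_wpM2l.
Qed.

Lemma vertex_max_value (mu vs : 'I_k -> R) gam opt :
  is_vertex C vs ->
  (forall v, is_vertex C v -> v <> vs -> dotv mu v + gam <= dotv mu vs) ->
  0 < gam -> is_max_value C mu opt -> opt = dotv mu vs.
Proof.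
move=> [Cvs _] gap gam0 [[p [Cp <-]] maxp]; apply/eqP; rewrite eq_le maxp// andbT.
move: p Cp {maxp}; apply: fair_polytope_ind => [v Vv|x y lam _ _ lam01 Qx Qy].
  by have [->//|/(gap _ Vv)] := pselect (v = vs); lra.
by rewrite dotv_mix; move/andP: lam01 => []; nra.
Qed.

(** The margins [d / 8] and [3 / 4 * d] add up to 7/8 of [d], hence to at most 7/8 of the loss of a
    suboptimal vertex; the remaining eighth gives the factor 8. *)
Lemma greedy_regret (mu m vs f h p : 'I_k -> R) gam d :
  is_vertex C vs ->
  (forall v, is_vertex C v -> v <> vs -> dotv mu v + gam <= dotv mu vs) ->
  0 < d <= gam ->
  (forall a, 0 <= f a) -> (forall a, 0 <= h a) ->
  (forall a, m a - mu a - d / 8 <= f a) ->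
  (forall a, mu a - m a - 3 / 4 * d <= h a) ->
  C p -> (forall q, C q -> dotv m q <= dotv m p) ->
  dotv mu vs - dotv mu p <= 8 * (dotv f p + dotv h vs).
Proof.
move=> [Cvs vvs] gap /andP[d0 dgam] f0 h0 mf mh.
move: p; apply: fair_polytope_ind => [v Vv maxv|x y lam Cx Cy /andP[l0 l1] Qx Qy maxm].
  have fv : 0 <= dotv f v by apply: dotv_ge0 => //; case: Vv => [[]].
  have hv : 0 <= dotv h vs by apply: dotv_ge0 => //; case: Cvs.
  have [->|/(gap _ Vv) gapv] := pselect (v = vs).
    have : 0 <= dotv f vs by apply: dotv_ge0 => //; case: Cvs.
    lra.
  have : dotv v m <= dotv v (fun a => f a + mu a) + d / 8.
    by apply: dotv_le_simplex => [|a]; [case: Vv|have := mf a; lra].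
  have : dotv vs mu <= dotv vs (fun a => h a + m a) + 3 / 4 * d.
    by apply: dotv_le_simplex => // a; have := mh a; lra.
  have dotvD (u w z : 'I_k -> R) : dotv u (fun a => w a + z a) = dotv w u + dotv z u.
    by rewrite /dotv -big_split; apply: eq_bigr => a _ /=; ring.
  rewrite !dotvD ![dotv v m]dotvC ![dotv vs mu]dotvC; have := maxv _ Cvs.
  lra.
(* If a mix with positive weights maximizes [m], so do both endpoints, and the induction hypotheses
   apply to them. *)
move: (maxm); rewrite dotv_mix => maxxy.
have mx := maxxy _ Cx; have my := maxxy _ Cy.
have e : dotv m x = dotv m y by nra.
have {}Qx : dotv mu vs - dotv mu x <= 8 * (dotv f x + dotv h vs).
  by apply: Qx => q /maxxy; rewrite e; lra.
have {}Qy : dotv mu vs - dotv mu y <= 8 * (dotv f y + dotv h vs).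
  by apply: Qy => q /maxxy; rewrite e; lra.
rewrite !dotv_mix; nra.
Qed.

(** Moving mass [eta] from [a] to another arm stays in the ball, hence in the polytope, where
    coordinates are nonnegative. *)
Lemma fair_ball_coord_ge (eta : R) (q : 'I_k -> R) a :
  (1 < k)%N -> 0 < eta -> C q ->
  (forall x : 'I_k -> R, (forall b, `|x b - q b| <= eta) ->
     \sum_b x b = 1 -> C x) ->
  eta <= q a.
Proof.
move=> k1 eta0 [q0 [q1 _]] ball.
have [b ba] : exists b : 'I_k, b != a.
  have : (0 < #|predC1 a|)%N by rewrite cardC1 card_ord -subn1 subn_gt0.
  by move=> /card_gt0P[b]; rewrite inE; exists b.
pose x c := q c + ((if c == b then eta else 0) - (if c == a then eta else 0)).
have [||x0 _] := ball x; first 1 last.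
- by rewrite big_split /= sumrB -!big_mkcond !big_pred1_eq subrr addr0.
- by have := x0 a; rewrite /x eqxx eq_sym (negbTE ba); lra.
- move=> c; rewrite /x addrAC subrr add0r.
  case: (eqVneq c b) => [->|_]; first by rewrite (negbTE ba) subr0 gtr0_norm.
  by rewrite sub0r normrN; case: eqP => _; rewrite ?normr0 ?gtr0_norm// ltW.
Qed.

End Greedy.

(** * Exponential potentials controlling the empirical means *)

Section Potential.
Variables (R : realType) (k T : nat).
Local Notation H := (history k T).
Implicit Types (h : H) (a : 'I_k).

Lemma upd_lt (X : finType) (h : {ffun 'I_T -> X}) (i j : 'I_T) x :
  (j < i)%N -> upd h i x j = h j.
Proof. by move=> ji; rewrite ffunE -(inj_eq val_inj) ltn_eqF. Qed.

Lemma adapted_pulls (S : Type) (idx : S) (op : S -> S -> S) (F : bool -> S) n a :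
  adapted n (fun h => \big[op/idx]_(j < T | (j < n)%N && ((h j).1 == a)) F (h j).2).
Proof.
move=> h i x ni; apply: eq_big => j; last first.
  by move=> /andP[jn _]; rewrite upd_lt// (leq_trans jn).
by have [jn|//] := ltnP j n; rewrite upd_lt// (leq_trans jn).
Qed.

Lemma adapted_emp_mean n : adapted n (fun h => emp_mean R h n).
Proof.
move=> h i x ni; apply: funext => a; rewrite /emp_mean /npulls /sumrew.
rewrite (adapted_pulls 0%N addn (fun=> 1%N) _ _ _ ni).
by rewrite (adapted_pulls 0 +%R (fun b => b%:R) _ _ _ ni).
Qed.

(** For [z] a centred reward with negative drift, this is the exponential supermartingale that moves
    only when [a] is pulled. *)
Definition potential (z : bool -> R) n a h : R :=
  expR (\sum_(j < T | (j < n)%N && ((h j).1 == a)) z (h j).2).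

Lemma potential_ge0 z n a h : 0 <= potential z n a h.
Proof. exact: expR_ge0. Qed.

Lemma potential0 z a h : potential z 0 a h = 1.
Proof. by rewrite /potential big_pred0 ?expR0. Qed.

Lemma adapted_potential z n a : adapted n (potential z n a).
Proof. by move=> h i x ni; rewrite /potential (adapted_pulls 0 +%R z _ _ _ ni). Qed.

Lemma potential_upd z (i : 'I_T) a h x :
  potential z i.+1 a (upd h i x)
  = potential z i a h * (if x.1 == a then expR (z x.2) else 1).
Proof.
rewrite -[potential z i a h](adapted_potential z a h x (leqnn i)) /potential.
set u := upd h i x; have ui : u i = x by rewrite ffunE eqxx.
have ltS (j : 'I_T) : (j < i.+1)%N && (j != i) = (j < i)%N.
  by rewrite -(inj_eq val_inj) ltnS [in RHS]ltn_neqAle andbC.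
case: ifP => xa.
  rewrite (bigD1 i) /=; last by rewrite ltnSn ui xa.
  rewrite expRD ui mulrC; congr (expR _ * _); apply: eq_bigl => j.
  by rewrite andbAC ltS.
rewrite mulr1; congr expR; apply: eq_bigl => j; rewrite -ltS.
by case: (eqVneq j i) => [->|]; rewrite ?ui ?xa ?andbF ?andbT.
Qed.

Lemma sum_pulls_affine h n a (l s c : R) :
  \sum_(j < T | (j < n)%N && ((h j).1 == a)) (l * (s * ((h j).2%:R - c)))
  = l * (s * (sumrew R h n a - (npulls h n a)%:R * c)).
Proof.
rewrite -!mulr_sumr sumrB /sumrew /npulls natr_sum mulr_suml; congr (_ * (_ * (_ - _))).
by apply: eq_bigr => j _; rewrite mul1r.
Qed.

Lemma emp_mean_bounds h n a : 0 <= emp_mean R h n a <= 1.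
Proof.
rewrite /emp_mean; case: eqP => [_|/eqP N0]; first by rewrite lexx ler01.
have Np : 0 < (npulls h n a)%:R :> R by rewrite ltr0n lt0n.
rewrite divr_ge0 ?sumr_ge0//= ler_pdivrMr// mul1r /sumrew /npulls natr_sum.
by apply: ler_sum => j _; rewrite ler_nat leq_b1.
Qed.

(** The default mean 0 of an unplayed arm is harmless, since both sides vanish. *)
Lemma sumrewE h n a :
  sumrew R h n a = (npulls h n a)%:R * emp_mean R h n a.
Proof.
rewrite /emp_mean; case: eqP => [N0|/eqP N0]; last first.
  by rewrite mulrC divfK// pnatr_eq0.
rewrite N0 mul0r /sumrew big1 // => j jP.
by move/eqP: N0; rewrite /npulls sum_nat_eq0 => /forallP/(_ j); rewrite jP.
Qed.

(** The left side never exceeds 1. When it is positive, the exponent is [l] times the number of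
    pulls times the left side, so the potential is at least 1. *)
Lemma overestimate_le_potential (l c m : R) h n a : 0 <= l -> 0 <= m -> 0 <= c ->
  emp_mean R h n a - m - c <= potential (fun b => l * (b%:R - m - c)) n a h.
Proof.
move=> l0 m0 c0; have /andP[_ mean1] := emp_mean_bounds h n a.
have [?|?] := leP (emp_mean R h n a - m - c) 0.
  exact: le_trans (potential_ge0 _ _ _ _).
apply: (@le_trans _ _ (expR 0)); first by rewrite expR0; lra.
rewrite ler_expR.
rewrite (eq_bigr (fun j => l * (1 * ((h j).2%:R - (m + c))))); last first.
  by move=> j _; ring.
rewrite sum_pulls_affine sumrewE -mulrBr mul1r !mulr_ge0//; lra.
Qed.

Lemma underestimate_le_potential (l c m : R) h n a : 0 <= l -> m <= 1 -> 0 <= c ->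
  m - emp_mean R h n a - c <= potential (fun b => l * (m - b%:R - c)) n a h.
Proof.
move=> l0 m1 c0; have /andP[mean0 _] := emp_mean_bounds h n a.
have [?|?] := leP (m - emp_mean R h n a - c) 0.
  exact: le_trans (potential_ge0 _ _ _ _).
apply: (@le_trans _ _ (expR 0)); first by rewrite expR0; lra.
rewrite ler_expR.
rewrite (eq_bigr (fun j => l * (-1 * ((h j).2%:R - (m - c))))); last first.
  by move=> j _; ring.
rewrite sum_pulls_affine sumrewE -mulrBr mulN1r -mulrN !mulr_ge0//; lra.
Qed.

End Potential.

(** * Decay recursion and the drift of the two potentials *)

Lemma harmonic_decay (R : realType) (U : nat -> R) (t0 : R) N :
  1 <= t0 -> U 0%N <= 1 -> (forall n, 0 <= U n) ->
  (forall n, (n < N)%N -> U n.+1 <= (1 - Num.min 1 (t0 / n.+1%:R) / t0) * U n) ->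
  forall n, (n <= N)%N -> U n <= 2 * t0 / n.+1%:R.
Proof.
move=> t01 U0 Uge Ustep n nN.
(* The invariant is a pair whose sum gives the claim, as [1 <= t0]. The first half suffices while
   [n.+1 <= t0]; afterwards the factor [1 - 1 / n.+1] keeps [n * U n] from growing. *)
suff [U1 nU] : U n <= 1 /\ n%:R * U n <= t0.
  by rewrite ler_pdivlMr ?ltr0n// -natr1; lra.
elim: n nN => [|n IH] nN; first by rewrite mul0r; split=> //; lra.
have [U1 nU] := IH (ltnW nN).
have np : 0 < n.+1%:R :> R by rewrite ltr0n.
have t0p : 0 < t0 by lra.
have le := Ustep n nN.
have decr : U n.+1 <= U n.
  apply: le_trans le _; rewrite ler_piMl// gerBl divr_ge0 ?(ltW t0p)//.
  by rewrite le_min ler01 divr_ge0// ltW.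
split; first exact: le_trans U1.
have [?|tn] := leP n.+1%:R t0.
  apply: (@le_trans _ _ (n.+1%:R * 1)); last lra.
  by rewrite ler_wpM2l ?(ltW np)// (le_trans decr).
have tn1 : t0 / n.+1%:R <= 1 by rewrite ler_pdivrMr// mul1r ltW.
move: le; rewrite (min_r tn1) mulrAC divff ?lt0r_neq0// mul1r.
move=> le; apply: le_trans (ler_wpM2l (ltW np) le) _.
by rewrite mulrA mulrBr mulr1 divff ?lt0r_neq0// -natr1 addrK.
Qed.

Lemma over_mgf (R : realType) (mu d : R) : 0 <= mu <= 1 -> 0 < d -> d <= 2^-1 ->
  mu * expR (d / 4 * (true%:R - mu - d / 8))
    + (1 - mu) * expR (d / 4 * (false%:R - mu - d / 8)) <= 1 - d ^+ 2 / 100.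
Proof.
move=> mu01 d0 d2; rewrite sub0r; apply: le_trans (bernoulli_mgf mu01 _ _) _; try lra.
have d4 : 0 <= 1 / 4 - d ^+ 2 by nra.
by have := mulr_ge0 (sqr_ge0 d) d4; have := sqr_ge0 d; lra.
Qed.

(** The drift [d ^+ 2 / 4] is matched to the exploration schedule: times [eta] it is exactly
    [1 / t0]. The wide margin [3 / 4 * d] pays for it. *)
Lemma under_mgf (R : realType) (mu d : R) : 0 <= mu <= 1 -> 0 < d -> d <= 2^-1 ->
  mu * expR (d / 2 * (mu - true%:R - 3 / 4 * d))
    + (1 - mu) * expR (d / 2 * (mu - false%:R - 3 / 4 * d)) <= 1 - d ^+ 2 / 4.
Proof.
move=> mu01 d0 d2; rewrite subr0; apply: le_trans (bernoulli_mgfN mu01 _ _) _; try lra.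
have d4 : 0 <= 1 / 4 - d ^+ 2 by nra.
by have := mulr_ge0 (sqr_ge0 d) d4; have := sqr_ge0 d; lra.
Qed.

(** * Expected regret under the law of the algorithm *)

Section Bandit.
Variables (R : realType) (k T : nat) (sel : nat -> ('I_k -> R) -> ('I_k -> R)).
Variables (qf mu : 'I_k -> R) (eta d : R).
Local Notation H := (history k T).

Definition arm_prob (i : nat) (h : H) a : R :=
  (1 - eps_t eta d i.+1) * sel i.+1 (emp_mean R h i) a + eps_t eta d i.+1 * qf a.

Definition kernel (i : 'I_T) (h : H) (x : 'I_k * bool) : R :=
  arm_prob i h x.1 * (if x.2 then mu x.1 else 1 - mu x.1).

Hypothesis mu01 : forall a, 0 <= mu a <= 1.
Hypothesis sel_ge0 : forall t m a, 0 <= sel t m a.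
Hypothesis sel_sum1 : forall t m, \sum_a sel t m a = 1.
Hypothesis qf_ge : forall a, eta <= qf a.
Hypothesis qf_sum1 : \sum_a qf a = 1.
Hypothesis eta0 : 0 < eta.
Hypothesis d0 : 0 < d.
Hypothesis d2 : d <= 2^-1.
Variable a0 : 'I_k.

Lemma eps_bounds t : 0 <= eps_t eta d t <= 1.
Proof.
apply/andP; split; last by rewrite ge_min lexx.
by rewrite le_min ler01 divr_ge0// !mulr_ge0 ?sqr_ge0// ltW.
Qed.

Lemma qf_ge0 a : 0 <= qf a.
Proof. exact: le_trans (ltW eta0) (qf_ge a). Qed.

Lemma arm_prob_ge0 i h a : 0 <= arm_prob i h a.
Proof.
have /andP[e0 e1] := eps_bounds i.+1.
by rewrite addr_ge0// mulr_ge0 ?subr_ge0 ?qf_ge0.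
Qed.

Lemma arm_prob_sum1 i h : \sum_a arm_prob i h a = 1.
Proof. by rewrite big_split /= -!mulr_sumr sel_sum1 qf_sum1; ring. Qed.

Lemma arm_prob_ge i h a : eps_t eta d i.+1 * eta <= arm_prob i h a.
Proof.
have /andP[e0 e1] := eps_bounds i.+1.
by rewrite ler_wpDl ?ler_wpM2l// mulr_ge0// subr_ge0.
Qed.

Lemma adapted_arm_prob i : adapted i (arm_prob i).
Proof.
by move=> h j x ij; apply: funext => a; rewrite /arm_prob adapted_emp_mean.
Qed.

Lemma adapted_kernel (i : 'I_T) : adapted i (kernel i).
Proof.
by move=> h j x ij; apply: funext => y; rewrite /kernel adapted_arm_prob.
Qed.

Lemma sum_kernel i h (F : 'I_k * bool -> R) :
  \sum_x kernel i h x * F x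
  = \sum_a arm_prob i h a * (mu a * F (a, true) + (1 - mu a) * F (a, false)).
Proof.
transitivity (\sum_a \sum_b kernel i h (a, b) * F (a, b)).
  by rewrite pair_bigA; apply: eq_bigr => -[].
by apply: eq_bigr => a _; rewrite big_bool /kernel /=; ring.
Qed.

Lemma kernel_sum1 i h : \sum_x kernel i h x = 1.
Proof.
under eq_bigr do rewrite -[kernel _ _ _]mulr1.
rewrite sum_kernel -[RHS](arm_prob_sum1 i h); apply: eq_bigr => a _; ring.
Qed.

Lemma kernel_ge0 i h x : 0 <= kernel i h x.
Proof.
have /andP[? ?] := mu01 x.1.
by rewrite mulr_ge0 ?arm_prob_ge0//; case: ifP; rewrite ?subr_ge0.
Qed.

Local Notation E := (expect kernel T).
Local Notation x0 := (a0, true).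

Lemma exp_fair_regretE opt :
  exp_fair_regret T sel qf mu eta d opt
  = \sum_(i < T) E (fun h => opt - dotv mu (arm_prob i h)).
Proof.
have -> : exp_fair_regret T sel qf mu eta d opt
    = E (fun h => \sum_(i < T) (opt - (h i).2%:R)).
  apply: eq_bigr => h _; rewrite sumrB sumr_const card_ord mulr_natl; congr (_ * _).
  (* At horizon [T] the test in [weight] always succeeds, which leaves [hist_prob]. *)
  by apply: eq_bigr => i _; rewrite ltn_ord.
rewrite expect_sum; apply: eq_bigr => i _.
rewrite (expect_cond adapted_kernel kernel_sum1 x0 (i := i)); last first.
  by move=> h j x ij; rewrite upd_lt.
congr expect; apply: funext => h; rewrite sum_kernel /=.
rewrite -[opt in RHS]mul1r -[in RHS](arm_prob_sum1 i h) mulr_suml -sumrB.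
by apply: eq_bigr => a _; rewrite !ffunE eqxx /=; ring.
Qed.

(** Only a pull of [a] changes the potential, and then by a mean factor at most [1 - kap]. *)
Lemma expect_potential_step (z : bool -> R) kap (i : 'I_T) a :
  mu a * expR (z true) + (1 - mu a) * expR (z false) <= 1 - kap ->
  E (potential z i.+1 a)
    <= E (fun h => potential z i a h * (1 - kap * arm_prob i h a)).
Proof.
move=> zle.
rewrite (expect_cond adapted_kernel kernel_sum1 x0 (i := i)); last exact: adapted_potential.
apply: expect_le => h; first exact: kernel_ge0.
under eq_bigr do rewrite potential_upd mulrCA.
rewrite -mulr_sumr ler_wpM2l ?potential_ge0// sum_kernel /=.
rewrite (eq_bigr (fun b => arm_prob i h b + (if b == a then arm_prob i h b *
    (mu b * expR (z true) + (1 - mu b) * expR (z false) - 1) else 0))).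
  rewrite big_split /= arm_prob_sum1 -big_mkcond big_pred1_eq.
  by have := ler_wpM2l (arm_prob_ge0 i h a) zle; lra.
by move=> b _; case: ifP => _; ring.
Qed.

(** Each summand times [kap] is at most the expected drop of the potential in that round; the drops
    telescope from 1 to a nonnegative value. *)
Lemma sum_expect_potential_le (z : bool -> R) kap a : 0 < kap ->
  mu a * expR (z true) + (1 - mu a) * expR (z false) <= 1 - kap ->
  \sum_(i < T) E (fun h => arm_prob i h a * potential z i a h) <= kap^-1.
Proof.
move=> kap0 zle; rewrite -[leRHS]mul1r ler_pdivlMr// mulrC mulr_sumr.
apply: (@le_trans _ _ (\sum_(i < T) (E (potential z i a) - E (potential z i.+1 a)))).
  apply: ler_sum => i _; rewrite lerBrDl addrC -lerBrDl.
  apply: le_trans (expect_potential_step i zle) _.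
  rewrite -expectZ -[- expect _ _ _]mulN1r -expectZ -expectD.
  apply: expect_le => h; first exact: kernel_ge0.
  lra.
rewrite -(big_mkord xpredT (fun i => E (potential z i a) - E (potential z i.+1 a))).
rewrite -[leLHS]opprK -sumrN (eq_bigr (fun i => E (potential z i.+1 a) - E (potential z i a))).
  rewrite telescope_sumr// opprB.
  have -> : E (potential z 0 a) = 1.
    rewrite -[RHS](expect_cst adapted_kernel kernel_sum1 x0).
    by congr expect; apply: funext => h; rewrite potential0.
  rewrite gerBl; rewrite -[leLHS](expect_cst adapted_kernel kernel_sum1 x0).
  by apply: expect_le => h; [exact: kernel_ge0|exact: potential_ge0].
by move=> i _; rewrite opprB.
Qed.

(** Forced exploration pulls [a] with probability at least [eps_t * eta], which yields the
    contraction required by [harmonic_decay]. *)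
Lemma expect_potential_decay (z : bool -> R) (i : 'I_T) a :
  mu a * expR (z true) + (1 - mu a) * expR (z false) <= 1 - d ^+ 2 / 4 ->
  1 <= 4 / (eta * d ^+ 2) ->
  E (potential z i a) <= 2 * (4 / (eta * d ^+ 2)) / i.+1%:R.
Proof.
move=> zle t01; pose U n := E (potential z n a).
apply: (@harmonic_decay _ U _ T) => //; last exact: ltnW.
- rewrite -[leRHS](expect_cst adapted_kernel kernel_sum1 x0).
  by apply: expect_le => h; [exact: kernel_ge0|rewrite potential0].
- move=> n; rewrite -[leLHS](expect_cst adapted_kernel kernel_sum1 x0).
  by apply: expect_le => h; [exact: kernel_ge0|exact: potential_ge0].
move=> n nT; apply: le_trans (expect_potential_step (Ordinal nT) zle) _.
rewrite /U -expectZ; apply: expect_le => h; first exact: kernel_ge0.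
rewrite mulrC ler_wpM2r ?potential_ge0// lerD2l lerN2.
have -> : 4 / (eta * d ^+ 2) / n.+1%:R = 4 / (eta * d ^+ 2 * n.+1%:R).
  by rewrite -mulrA -invfM.
rewrite -/(eps_t eta d n.+1) invf_div.
have -> : eps_t eta d n.+1 * (eta * d ^+ 2 / 4) = d ^+ 2 / 4 * (eps_t eta d n.+1 * eta).
  by ring.
by rewrite ler_wpM2l ?arm_prob_ge// divr_ge0 ?sqr_ge0.
Qed.

(** With [t0 = 4 / (eta * d ^+ 2)], round [t] costs [t0 / t] for exploration and [8 * 2 * t0 / t]
    for underestimation, whence [68 = 17 * 4]. Overestimation adds [8 * 100], and
    [868 = 68 + 800]. *)
Lemma expected_regret_le (vs : 'I_k -> R) opt :
  (0 < T)%N ->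
  (forall a, 0 <= vs a) -> \sum_a vs a = 1 ->
  k%:R * eta <= 1 -> opt <= 1 ->
  (forall (i : 'I_T) (h : H),
     opt - dotv mu (sel i.+1 (emp_mean R h i))
     <= 8 * (dotv (fun a => potential (fun b => d / 4 * (b%:R - mu a - d / 8)) i a h)
                  (sel i.+1 (emp_mean R h i))
           + dotv (fun a => potential (fun b => d / 2 * (mu a - b%:R - 3 / 4 * d)) i a h)
                  vs)) ->
  exp_fair_regret T sel qf mu eta d opt
  <= (868 + 68 * ln T%:R) / (eta * d ^+ 2).
Proof.
move=> T0 vs0 vs1 keta opt1 greedy; rewrite exp_fair_regretE.
pose over i a := potential (fun b => d / 4 * (b%:R - mu a - d / 8)) i a : H -> R.
pose under i a := potential (fun b => d / 2 * (mu a - b%:R - 3 / 4 * d)) i a : H -> R.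
have etad : 0 < eta * d ^+ 2 by rewrite mulr_gt0 ?exprn_gt0.
pose t0 := 4 / (eta * d ^+ 2).
have t01 : 1 <= t0.
  rewrite ler_pdivlMr// mul1r (@le_trans _ _ (1 * 1))//; last lra.
  have k1 : 1 <= k%:R :> R by rewrite ler1n (leq_ltn_trans _ (ltn_ord a0)).
  have := eta0; have := d0; have := d2; move=> d2' d0' eta0'.
  rewrite ler_pM ?sqr_ge0 ?(ltW eta0')//; last by nra.
  by apply: le_trans keta; rewrite ler_peMl// ltW.
have over_sum a : \sum_(i < T) E (fun h => arm_prob i h a * over i a h) <= 100 / d ^+ 2.
  rewrite -[leRHS]invf_div; apply: sum_expect_potential_le; last exact: over_mgf.
  by rewrite divr_gt0 ?exprn_gt0.
have under_le (i : 'I_T) a : E (under i a) <= 2 * t0 / i.+1%:R.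
  by apply: expect_potential_decay => //; exact: under_mgf.
have round (i : 'I_T) : E (fun h => opt - dotv mu (arm_prob i h))
    <= 17 * t0 * i.+1%:R^-1 + 8 * \sum_a E (fun h => arm_prob i h a * over i a h).
  apply: (@le_trans _ _ (E (fun h => eps_t eta d i.+1
    + 8 * (\sum_a arm_prob i h a * over i a h + \sum_a vs a * under i a h)))).
    apply: expect_le => h; first exact: kernel_ge0.
    have /andP[e0 e1] := eps_bounds i.+1.
    have := greedy i h; set p := sel _ _; rewrite -/(over i) -/(under i) => gr.
    have -> : dotv mu (arm_prob i h)
        = (1 - eps_t eta d i.+1) * dotv mu p + eps_t eta d i.+1 * dotv mu qf.
      rewrite /dotv !mulr_sumr -big_split; apply: eq_bigr => a _.
      by rewrite /= /arm_prob -/p; ring.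
    have qf0 : 0 <= dotv mu qf.
      by apply: dotv_ge0 => a; [case/andP: (mu01 a)|exact: qf_ge0].
    have under0 : 0 <= \sum_a vs a * under i a h.
      by apply: sumr_ge0 => a _; rewrite mulr_ge0 ?potential_ge0.
    (* The exploitation part of the play probability converts the weight [p a] into actual pulls, as
       the telescoping bound needs. *)
    have over_le : (1 - eps_t eta d i.+1) * dotv (over i ^~ h) p
        <= \sum_a arm_prob i h a * over i a h.
      rewrite mulr_sumr; apply: ler_sum => a _.
      rewrite [_ * p a]mulrC mulrA ler_wpM2r ?potential_ge0// /arm_prob lerDl.
      by rewrite mulr_ge0 ?qf_ge0.
    have {}gr : opt - dotv mu p <= 8 * (dotv (over i ^~ h) p + \sum_a vs a * under i a h).
      by move: gr; rewrite [dotv _ vs]dotvC.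
    by move: (dotv (over i ^~ h) p) (\sum_a vs a * under i a h) 
      (\sum_a arm_prob i h a * over i a h) under0 over_le gr => X Y Z; nra.
  rewrite expectD (expect_cst adapted_kernel kernel_sum1 x0) expectZ expectD !expect_sum.
  have eps_le : eps_t eta d i.+1 <= t0 / i.+1%:R.
    by rewrite /t0 /eps_t ge_min -mulrA -invfM lexx orbT.
  have : \sum_a E (fun h => vs a * under i a h) <= 2 * t0 / i.+1%:R.
    rewrite -[leRHS]mul1r -[X in X * _]vs1 mulr_suml; apply: ler_sum => a _.
    by rewrite expectZ ler_wpM2l ?under_le.
  rewrite -[17 * t0 / _]mulrA -[2 * t0 / _]mulrA; move: eps_le.
  by move: (t0 / _) => c; lra.
apply: le_trans (ler_sum _ (fun i _ => round i)) _.
rewrite big_split /= -!mulr_sumr exchange_big /=.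
have harm : \sum_(i < T) i.+1%:R^-1 <= 1 + ln T%:R :> R.
  by case: (T) T0 => // n _; exact: harmonic_le_ln.
(* Summing over arms costs a factor [k], which [k * eta <= 1] turns into [1 / eta]. *)
have overs : \sum_a \sum_(i < T) E (fun h => arm_prob i h a * over i a h)
    <= 100 / (eta * d ^+ 2).
  apply: le_trans (ler_sum _ (fun a _ => over_sum a)) _.
  rewrite sumr_const card_ord -[_ *+ k]mulr_natr -mulrA (invfM eta) ler_pM2l//.
  by rewrite mulrC ler_pM2r ?invr_gt0 ?exprn_gt0// -[leRHS]mul1r ler_pdivlMr.
have t0p : 0 <= 17 * t0 by lra.
have -> : (868 + 68 * ln T%:R) / (eta * d ^+ 2)
    = 17 * t0 * (1 + ln T%:R) + 8 * (100 / (eta * d ^+ 2)).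
  have := lt0r_neq0 eta0; have := lt0r_neq0 d0 => d_neq eta_neq.
  by rewrite /t0; field; rewrite d_neq eta_neq.
by apply: lerD; [exact: ler_wpM2l|rewrite ler_pM2l].
Qed.

End Bandit.

(** * Assembly and choice of the absolute constant *)

Theorem theorem2 (R : realType) :
  exists C : R, 0 < C /\
  forall (k g T : nat) (G : 'I_g -> {set 'I_k}) (lo up : 'I_g -> R)
         (mu : 'I_k -> R) (gam eta opt : R) (qf : 'I_k -> R)
         (sel : nat -> ('I_k -> R) -> ('I_k -> R)),
    (2 <= k)%N -> (1 <= g)%N -> (2 <= T)%N ->
    (forall i, 0 <= lo i /\ lo i <= up i /\ up i <= 1) ->
    (forall a, 0 <= mu a <= 1) ->
    vertex_gap (fair_polytope G lo up) mu gam -> 0 < gam ->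
    0 < eta ->
    fair_polytope G lo up qf ->
    (forall x : 'I_k -> R, (forall a, `|x a - qf a| <= eta) ->
       \sum_(a < k) x a = 1 -> fair_polytope G lo up x) ->
    (* p^t is some maximizer of mbar_t . p over the polytope *)
    (forall t m, fair_polytope G lo up (sel t m) /\
       forall p, fair_polytope G lo up p -> dotv m p <= dotv m (sel t m)) ->
    is_max_value (fair_polytope G lo up) mu opt ->
    exp_fair_regret T sel qf mu eta (Num.min gam (1/2)) opt
      <= C * ln (T%:R) / (eta * gam ^+ 2).
Proof.
(* Since [ln T >= 1/2], 868 is at most [1736 * ln T]; replacing [d] by [gam] costs a factor 4, and
   [7216 = 4 * (1736 + 68)]. *)
exists 7216; split=> // k g T G lo up mu gam eta opt qf sel k2 _ T2 _ mu01
  [vs [Vvs [gap [v [Vv [_ vgap]]]]]] gam0 eta0 Cqf ball selP optP.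
have optE := vertex_max_value Vvs gap gam0 optP.
have Cvs : fair_polytope G lo up vs by case: Vvs.
have Cv : fair_polytope G lo up v by case: Vv.
have mu0 a : 0 <= mu a by case/andP: (mu01 a).
have opt1 : opt <= 1.
  rewrite optE dotvC -[leRHS]add0r.
  have -> : 0 = dotv vs (fun=> 0) :> R by rewrite /dotv big1// => a _; rewrite mulr0.
  by apply: (dotv_le_simplex Cvs) => a; rewrite add0r; case/andP: (mu01 a).
(* The second vertex bounds the gap by 1, so [gam <= 2 * d] even when the minimum defining [d] is
   1/2. *)
have gam1 : gam <= 1.
  have : 0 <= dotv mu v by apply: dotv_ge0 => //; case: Cv.
  by rewrite optE in opt1; lra.
have qf_ge a := fair_ball_coord_ge a k2 eta0 Cqf ball.
have keta : k%:R * eta <= 1.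
  apply: (@le_trans _ _ (\sum_a qf a)); last by case: Cqf => _ [->].
  by rewrite mulr_natl -[X in _ *+ X]card_ord -sumr_const; exact: ler_sum.
set d := Num.min gam (1 / 2).
have d0 : 0 < d by rewrite lt_min gam0; lra.
have d2 : d <= 2^-1 by rewrite ge_min mul1r lexx orbT.
have dgam : d <= gam by rewrite ge_min lexx.
have gam2d : gam <= 2 * d by rewrite /d minEle; case: ifP => _; lra.
have sel1 t m : \sum_a sel t m a = 1 by case: (selP t m) => -[_ []].
have sel0 t m a : 0 <= sel t m a by case: (selP t m) => -[].
have qf1 : \sum_a qf a = 1 by case: Cqf => _ [].
have [vs0 [vs1 _]] := Cvs.
have a0 : 'I_k by exact: (Ordinal k2).
apply: (@le_trans _ _ ((868 + 68 * ln T%:R) / (eta * d ^+ 2))).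
  apply: (expected_regret_le mu01 sel0 sel1 qf_ge qf1 eta0 d0 d2 a0 (ltnW T2)
    vs0 vs1 keta opt1).
  move=> i h; rewrite optE.
  have [Cp pmax] := selP i.+1 (emp_mean R h i).
  apply: (greedy_regret (d := d) Vvs gap _ _ _ _ _ Cp pmax); first by rewrite d0.
  - by move=> a; exact: potential_ge0.
  - by move=> a; exact: potential_ge0.
  - by move=> a; apply: overestimate_le_potential => //; lra.
  - by move=> a; apply: underestimate_le_potential; [lra|case/andP: (mu01 a)|lra].
have lnT := half_le_ln R T2.
have gd : gam ^+ 2 <= 4 * d ^+ 2 by nra.
rewrite ler_pdivlMr ?mulr_gt0 ?exprn_gt0//.
have -> : (868 + 68 * ln T%:R) / (eta * d ^+ 2) * (eta * gam ^+ 2)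
  = (868 + 68 * ln T%:R) * (gam ^+ 2 / d ^+ 2).
  by field; rewrite !lt0r_neq0.
have : gam ^+ 2 / d ^+ 2 <= 4 by rewrite ler_pdivrMr// exprn_gt0.
move: (gam ^+ 2 / d ^+ 2) => r r4.
by apply: (@le_trans _ _ ((868 + 68 * ln T%:R) * 4)); [rewrite ler_wpM2l//|]; lra.
Qed.
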